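(* If $G$ is a graph with no induced subgraph isomorphic to $2K_2$, then $\operatorname{reg}(G)\le\frac{1}{2}\Gamma(G)+2$.
   Context: $2K_2$ is the disjoint union of two edges. The maximum privacy degree is $\Gamma(G)=\max\{|N_G[x]\setminus N_G[y]|: x,y\in V(G),\ xy\in E(G)\}$ (taken over both orderings of each edge; $0$ if $G$ has no edges), where $N_G[x]=N_G(x)\cup\{x\}$. $\operatorname{reg}(G)=\max\{j\ge0:\widetilde H_{j-1}(\operatorname{Ind}(G[S]);\Bbbk)\neq0\text{ for some }S\subseteq V(G)\}$ over a field $\Bbbk$, $\operatorname{Ind}$ the independence complex. *)

(* Defs.v *)
From HB Require Import structures.
From mathcomp Require Import all_boot all_order all_algebra.
Set Implicit Arguments. Unset Strict Implicit. Unset Printing Implicit Defensive.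
Import GRing.Theory.

Section Defs.
Variable T : finType.

Definition simple_graph (e : rel T) := symmetric e /\ irreflexive e.

Definition cnbhd (e : rel T) (x : T) : {set T} := x |: [set y | e x y].

(* maximum privacy degree; 0 if there are no edges *)
Definition max_privacy (e : rel T) : nat :=
  \max_(p : T * T | e p.1 p.2) #|cnbhd e p.1 :\: cnbhd e p.2|.

(* G has no induced subgraph isomorphic to 2K_2: there are no four distinct
   vertices a,b,c,d with edges ab, cd and non-edges ac, ad, bc, bd
   (distinctness of a,b,c,d is automatic from irreflexivity and the
   edge/non-edge pattern). *)
Definition twoK2_free (e : rel T) : Prop :=
  ~ exists a b c d : T,
      [&& e a b, e c d, ~~ e a c, ~~ e a d, ~~ e b c & ~~ e b d].

Definition indep (e : rel T) (s : {set T}) : bool :=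
  [forall x in s, forall y in s, ~~ e x y].

(* faces of Ind(G[S]) : independent subsets of S (incl. the empty face) *)
Definition ind_complex (e : rel T) (S : {set T}) : {set {set T}} :=
  [set s : {set T} | (s \subset S) && indep e s].

Definition pos_in (s : {set T}) (v : T) : nat :=
  #|[set u in s | enum_rank u < enum_rank v]|.

Variable F : fieldType.

Notation N := #|{: {set T}}|.

(* boundary map from the faces of size k of K to faces of size k-1,
   as a matrix indexed by all subsets of T (rows: domain). *)
Definition bdry (K : {set {set T}}) (k : nat) : 'M[F]_N :=
  \matrix_(i, j)
    (let s := enum_val i in let t := enum_val j in
     if [pick v in s :\: t] is Some v then
       if [&& s \in K, #|s| == k & t == s :\ v]
       then (-1) ^+ (pos_in s v) else 0
     else 0)%R.

Definition nfaces (K : {set {set T}}) (k : nat) : nat :=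
  #|[set s in K | #|s| == k]|.

(* dim of reduced homology  H~_{k-1}(K; F)  (faces of size k have dim k-1):
   dim C_{k-1} - rank d_{k-1} - rank d_k, where d_{k-1} is [bdry K k]
   (with bdry K 0 = 0 since no face of size 0 has a boundary). *)
Definition rhomology_dim (K : {set {set T}}) (k : nat) : nat :=
  nfaces K k - \rank (bdry K k) - \rank (bdry K k.+1).

(* Castelnuovo–Mumford regularity over F, via Hochster's formula:
   reg(G) = max { j >= 0 : H~_{j-1}(Ind(G[S]); F) <> 0 for some S }.
   Such j satisfy j <= #|T| (a face of size j is needed), so the max is over
   j < #|T|.+2. *)
Definition reg (e : rel T) : nat :=
  \max_(j < #|T|.+2 | [exists S : {set T}, rhomology_dim (ind_complex e S) j != 0]) j.

End Defs.

(* Main.v *)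
Require Import Defs.
From HB Require Import structures.
From mathcomp Require Import all_boot all_order all_algebra.
From mathcomp Require Import zify.
Set Implicit Arguments. Unset Strict Implicit. Unset Printing Implicit Defensive.
Import GRing.Theory Num.Theory.

(** Deleting a vertex [x] costs nothing or passes to [G - N[x]] one homological
    degree lower. If [xy] is an edge, the vertices of [G - N[x]] not adjacent to
    [y] are independent, so [G - N[x]] is covered by an independent set [B] and at
    most [Gamma] further vertices. In such a graph, deleting [N[x]] for [x] the end
    of an edge outside [B] kills two vertices outside [B] per degree; once no such
    edge is left the graph is bipartite and 2K2-free, hence of regularity at
    most 1. *)

(** * Chains, signs and the cone homotopy *)

Section Chains.
Variables (F : fieldType) (T : finType).
Implicit Types (c z w : {set T} -> F) (s t S : {set T}) (x v : T).
Local Open Scope ring_scope.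

Definition sgn s v : F := (-1) ^+ pos_in s v.

(** The boundary is given by coefficients, each [t] collecting from its cofaces. No complex enters;
    supports are tracked separately by [chain_on]. *)
Definition bd c : {set T} -> F :=
  fun t => \sum_(v | v \notin t) sgn t v * c (v |: t).

(* Cone with apex [x]; faces already containing [x] are sent to 0. *)
Definition join x c : {set T} -> F :=
  fun s => if x \in s then sgn s x * c (s :\ x) else 0.

Lemma sgn_sqr s v : sgn s v * sgn s v = 1.
Proof. by rewrite -expr2 sqrr_sign. Qed.

Lemma pos_inU s u v : u \notin s ->
  pos_in (u |: s) v = ((enum_rank u < enum_rank v) + pos_in s v)%N.
Proof.
move=> us; rewrite /pos_in.
have [uv|uv] := ltnP (enum_rank u) (enum_rank v).
  rewrite (_ : [set w in u |: s | _] =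
    u |: [set w in s | (enum_rank w < enum_rank v)%N]).
    by rewrite cardsU1 !inE (negbTE us).
  by apply/setP=> w; rewrite !inE; case: eqP => [->|] //=; rewrite uv.
rewrite add0n; congr #|pred_of_set _|; apply/setP=> w; rewrite !inE.
by case: eqP => [->|] //=; rewrite ltnNge uv (negbTE us).
Qed.

Lemma sgnUid s v : sgn (v |: s) v = sgn s v.
Proof.
have [vs|vs] := boolP (v \in s); last by rewrite /sgn pos_inU // ltnn.
by rewrite (setUidPr _) // sub1set.
Qed.

Lemma sgnD1id s v : sgn (s :\ v) v = sgn s v.
Proof.
have [vs|vs] := boolP (v \in s); first by rewrite -{2}(setD1K vs) sgnUid.
congr sgn; apply/setP=> w; rewrite !inE; case: eqP => [->|] //=.
by rewrite (negbTE vs).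
Qed.

(** Exactly one of [x] and [v] precedes the other, so exactly one of the two signs flips. *)
Lemma sgn_swap s x v : x \notin s -> v \notin s -> x != v ->
  sgn (x |: s) v * sgn (v |: s) x = - (sgn s x * sgn s v).
Proof.
move=> xs vs xv; rewrite /sgn !pos_inU // !exprD.
have : enum_rank x != enum_rank v :> nat.
  by apply: contra_neq xv => /ord_inj/enum_rank_inj.
by case: ltngtP => // _ _; rewrite ?(expr0, expr1, mul1r, mulN1r, mulNr, mulrN);
  rewrite mulrC.
Qed.

(** Coning contracts the full simplex. If [x] is not in [t], only the coface [x |: t] contributes;
    otherwise the terms with [v != x] cancel by [sgn_swap]. *)
Lemma bd_join x c t : bd (join x c) t + join x (bd c) t = c t.
Proof.
rewrite /bd {2}/join; case: ifPn => xt; last first.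
  rewrite addr0 (bigD1 x) //= big1 => [|v /andP[vt vx]].
    by rewrite addr0 /join setU11 setU1K // sgnUid mulrA sgn_sqr mul1r.
  by rewrite /join !inE eq_sym (negbTE vx) (negbTE xt) mulr0.
rewrite [X in _ + _ * X](bigD1 x) /=; last by rewrite !inE eqxx.
rewrite setD1K // sgnD1id mulrDr mulrA sgn_sqr mul1r addrCA mulr_sumr.
rewrite [X in _ + (X + _)](eq_bigl (fun v => (v \notin t :\ x) && (v != x))) =>[|v]; last first.
  by rewrite !inE; case: eqP => [->|] //=; rewrite ?xt ?andbF ?andbT.
rewrite -big_split /= big1 ?addr0 // => v /andP[vt vx].
have xt' : x \notin t :\ x by rewrite !inE eqxx.
have vt' : v \notin t by move: vt; rewrite !inE vx.
rewrite /join !inE xt orbT.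
have -> : (v |: t) :\ x = v |: (t :\ x).
  by apply/setP=> w; rewrite !inE; case: (eqVneq w v) => [->|] //=; rewrite ?vx.
rewrite !mulrA -mulrDl.
have -> : sgn t v * sgn (v |: t) x = - (sgn (t :\ x) x * sgn (t :\ x) v).
  rewrite -sgn_swap // 1?eq_sym // setD1K //; congr (_ * _).
  rewrite -[LHS]sgnD1id; congr sgn.
  by apply/setP=> w; rewrite !inE; case: (eqVneq w v) => [->|] //=; rewrite ?vx.
by rewrite sgnD1id addNr mul0r.
Qed.

Lemma bdD c1 c2 t : bd (fun s => c1 s + c2 s) t = bd c1 t + bd c2 t.
Proof. by rewrite -big_split; apply: eq_bigr => v _; rewrite mulrDr. Qed.

Lemma bdB c1 c2 t : bd (fun s => c1 s - c2 s) t = bd c1 t - bd c2 t.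
Proof. by rewrite -sumrB; apply: eq_bigr => v _; rewrite mulrBr. Qed.

Lemma eq_bd c1 c2 : c1 =1 c2 -> bd c1 =1 bd c2.
Proof. by move=> E t; apply: eq_bigr => v _; rewrite E. Qed.

(** * Acyclicity of independence complexes *)

Variable e : rel T.
Hypothesis e_simple : simple_graph e.

Let e_sym : symmetric e. Proof. by case: e_simple. Qed.
Let e_irr : irreflexive e. Proof. by case: e_simple. Qed.

Definition chain_on (K : {set {set T}}) (k : nat) c :=
  forall s, c s != 0 -> s \in K /\ #|s| = k.

(** Exactness in homological degree [k - 1], phrased with fillings so that they can be glued. *)
Definition acyc (K : {set {set T}}) (k : nat) :=
  forall z, chain_on K k z -> bd z =1 (fun=> 0) ->
  exists2 w, chain_on K k.+1 w & bd w =1 z.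

Lemma indepP s : reflect {in s &, forall x y, ~~ e x y} (indep e s).
Proof.
apply: (iffP forall_inP) => [H x y xs ys|H x xs]; first exact: (forall_inP (H x xs)).
by apply/forall_inP => y ys; apply: H.
Qed.

Lemma indep_sub s t : s \subset t -> indep e t -> indep e s.
Proof. by move=> /subsetP st /indepP It; apply/indepP=> x y /st xt /st; apply: It. Qed.

Lemma indepU1 s x : indep e s -> {in s, forall y, ~~ e x y} -> indep e (x |: s).
Proof.
move=> /indepP Is xs; apply/indepP => y1 y2; rewrite !inE.
case/predU1P=> [->|ys1]; case/predU1P=> [->|ys2]; rewrite ?e_irr //.
- exact: xs.
- by rewrite e_sym xs.
- exact: Is.
Qed.

(** An isolated vertex [x] makes the complex a cone, so [join x z] fills [z] by [bd_join]. *)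
Lemma acyc_cone S x k : x \in S -> {in S, forall y, ~~ e x y} ->
  acyc (ind_complex e S) k.
Proof.
move=> xS xiso z zK dz; exists (join x z) => [s|t]; last first.
  rewrite -[RHS](bd_join x) {3}/join dz mulr0; case: ifP; by rewrite addr0.
rewrite /join; case: ifP => [xs|_]; last by rewrite eqxx.
rewrite mulf_eq0 => /norP[_ /zK]; rewrite inE => -[/andP[sS sI] sk].
rewrite -(setD1K xs) cardsU1 !inE eqxx sk; split=> //.
rewrite subUset sub1set xS sS indepU1 // => y /(subsetP sS); exact: xiso.
Qed.

(* Mayer-Vietoris for the deletion and the link of [x], at the level of cycles. *)
Lemma acyc_del S x k :
  acyc (ind_complex e (S :\ x)) k.+1 ->
  acyc (ind_complex e (S :\: cnbhd e x)) k ->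
  acyc (ind_complex e S) k.+1.
Proof.
have [xS|xS] := boolP (x \in S); last first.
  move=> + _; suff -> : S :\ x = S by [].
  by apply/setP=> w; rewrite !inE; case: eqP => [->|] //=; rewrite (negbTE xS).
move=> Hdel Hlk z zK dz.
(* Split [z] into [join x a], with [a] living on the link of [x], and [b] on the deletion. *)
pose a s := if x \in s then 0 else sgn s x * z (x |: s).
pose b s := if x \in s then 0 else z s.
have zE s : z s = join x a s + b s.
  rewrite /join /a /b; case: ifP => xs; last by rewrite add0r.
  by rewrite !inE eqxx /= setD1K // sgnD1id mulrA sgn_sqr mul1r addr0.
have bd0 c t : (forall s, x \in s -> c s = 0) -> x \in t -> bd c t = 0.
  move=> c0 xt; rewrite /bd big1 // => v _.
  by rewrite c0 ?mulr0 // !inE xt orbT.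
have a0 s : x \in s -> a s = 0 by rewrite /a => ->.
have b0 s : x \in s -> b s = 0 by rewrite /b => ->.
(* This is [bd z = 0] expanded: faces without [x] yield [bd b = - a], faces with [x] yield
   [bd a = 0]. *)
have key t : a t - join x (bd a) t + bd b t = 0.
  by rewrite -[a t](bd_join x) addrK -bdD -(dz t); apply: eq_bd => s; rewrite zE.
have dbE t : bd b t = - a t.
  have [xt|xt] := boolP (x \in t); first by rewrite bd0 // a0 // oppr0.
  move: (key t); rewrite {1}/join (negbTE xt) subr0 addrC => /eqP.
  by rewrite addr_eq0 => /eqP.
have da t : bd a t = 0.
  have [xt|xt] := boolP (x \in t); first exact: bd0.
  move: (key (x |: t)); rewrite dbE addrAC subrr add0r /join setU11 setU1K //.
  by move/eqP; rewrite oppr_eq0 mulf_eq0 signr_eq0 => /eqP.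
have aK : chain_on (ind_complex e (S :\: cnbhd e x)) k a.
  move=> s; rewrite /a; case: ifPn => [|xs]; first by rewrite eqxx.
  rewrite mulf_eq0 => /norP[_ /zK]; rewrite inE cardsU1 xs => -[/andP[sS /indepP sI] []].
  move=> sk; split=> //; rewrite inE; apply/andP; split; last first.
    by apply/indepP=> u v us vs; apply: sI; rewrite inE ?us ?vs orbT.
  apply/subsetP=> v vs; rewrite !inE (subsetP sS) ?inE ?vs ?orbT // andbT.
  rewrite negb_or (sI x v) ?inE ?eqxx ?vs ?orbT // andbT.
  by apply: contraNneq xs => <-.
(* Since [bd w = a], the chain [b + w] is a cycle of the deletion. *)
have [w wK wE] := Hlk a aK da.
have [] := Hdel (fun s => b s + w s).
- move=> s; have [bs|bs] := eqVneq (b s) 0.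
    rewrite bs add0r => /wK [+ ->]; rewrite !inE => /andP[sS ->]; split=> //.
    rewrite andbT; apply: subset_trans sS _; apply/subsetP=> v; rewrite !inE.
    by rewrite negb_or => /andP[/andP[-> _] ->].
  move: bs; rewrite /b; case: ifPn => [|xs /zK [+ ->] _]; first by rewrite eqxx.
  rewrite !inE => /andP[sS ->]; split=> //; rewrite andbT.
  by rewrite subsetD1 sS.
- by move=> t; rewrite bdD dbE wE addNr.
(* As [bd (join x w) = w - join x a], subtracting it from [bd u = b + w] leaves
   [b + join x a = z]. *)
move=> u uK uE; exists (fun s => u s - join x w s) => [s|t]; last first.
  rewrite bdB uE zE.
  have -> : bd (join x w) t = w t - join x a t.
    rewrite -[w t](bd_join x); suff -> : join x (bd w) t = join x a t by rewrite addrK.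
    by rewrite /join; case: ifP => // _; rewrite wE.
  by rewrite opprB addrACA subrr addr0 addrC.
have [us|us] := eqVneq (u s) 0; last first.
  case: (uK _ us) => + -> _; rewrite !inE => /andP[sS ->]; split=> //.
  by rewrite (subset_trans sS) ?subD1set.
rewrite us sub0r oppr_eq0 /join; case: ifP => [xs|_]; last by rewrite eqxx.
rewrite mulf_eq0 => /norP[_ /wK]; rewrite inE => -[/andP[sS sI] sk].
rewrite -(setD1K xs) cardsU1 !inE eqxx sk; split=> //.
rewrite subUset sub1set xS (subset_trans sS) ?subsetDl // indepU1 // => y.
by move=> /(subsetP sS); rewrite !inE negb_or => /andP[/andP[]].
Qed.

Lemma acyc_indep S k : indep e S -> acyc (ind_complex e S) k.+1.
Proof.
move=> /indepP SI; have [->|[x xS]] := set_0Vmem S; last first.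
  by apply: (acyc_cone xS) => y; apply: SI.
(* Here [S] is empty and its only face has size 0, so a chain in size [k.+1] vanishes. *)
move=> z zK _; exists (fun=> 0) => [s|t]; first by rewrite eqxx.
rewrite /bd big1 => [|v _]; last by rewrite mulr0.
apply/esym/eqP; apply/negPn/negP => /zK[]; rewrite inE subset0 => /andP[/eqP-> _].
by rewrite cards0.
Qed.

(** * From chains to matrix ranks *)

(** The support condition reconciles [bd], which ignores [K] and [k], with a matrix whose rows
    vanish off the faces of size [k]. *)
Lemma mul_bdry K k (z : 'rV[F]_(#|{: {set T}}|)) j :
  chain_on K k (fun s => z 0 (enum_rank s)) ->
  (z *m bdry F K k) 0 j = bd (fun s => z 0 (enum_rank s)) (enum_val j).
Proof.
move=> zK; rewrite mxE /bd; set t := enum_val j.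
rewrite (reindex_onto enum_rank enum_val) /=; last by move=> i _; rewrite enum_valK.
rewrite (eq_bigl xpredT) => [|s]; last by rewrite enum_rankK eqxx.
rewrite (bigID (mem [set v |: t | v in ~: t])) /= [X in _ + X]big1 ?addr0; last first.
  move=> s sn; rewrite mxE /= enum_rankK -/t; case: pickP => [v|_]; last by rewrite mulr0.
  rewrite inE => /andP[vt vs]; case: ifP => [/and3P[_ _ /eqP tE]|]; last by rewrite mulr0.
  case/negP: sn; apply/imsetP; exists v; rewrite ?inE //.
  by rewrite tE setD1K.
rewrite big_imset /=; last first.
  move=> u v; rewrite !inE => ut vt E.
  have: u \in v |: t by rewrite -E setU11.
  by rewrite !inE (negbTE ut) orbF => /eqP.
apply: eq_big => [v|v]; rewrite inE // => vt.
have [->|zv] := eqVneq (z 0 (enum_rank (v |: t))) 0; first by rewrite mul0r mulr0.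
case: (zK _ zv) => vK vk; rewrite mulrC mxE /= enum_rankK -/t.
case: pickP => [u|/(_ v)]; last by rewrite !inE eqxx vt.
rewrite !inE => /andP[ut]; rewrite (negbTE ut) orbF => /eqP->.
by rewrite vK vk eqxx setU1K // eqxx /= -/(sgn _ _) sgnUid.
Qed.

Lemma acyc_rhomology K k : acyc K k -> rhomology_dim F K k = 0%N.
Proof.
move=> Kk; pose fs := [set s in K | #|s| == k].
(* The rows of [P] are the basis vectors of the faces of size [k], so [P :&: kermx (bdry F K k)] is
   the cycle space. *)
pose P : 'M[F]_(#|fs|, #|{: {set T}}|) :=
  \matrix_(i, j) ((enum_val i == enum_val j)%:R).
have rP : \rank P = nfaces K k.
  apply/eqP; rewrite -/(row_free P); apply/row_freeP; exists P^T.
  apply/matrixP=> i j; rewrite !mxE (bigD1 (enum_rank (enum_val i))) //=.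
  rewrite !mxE enum_rankK eqxx mul1r (inj_eq enum_val_inj) eq_sym big1 ?addr0 // => l li.
  rewrite !mxE; case: eqP => [E|]; last by rewrite mul0r.
  by move: li; rewrite E enum_valK eqxx.
have := mxrank_mul_ker P (bdry F K k).
have : (P :&: kermx (bdry F K k) <= bdry F K k.+1)%MS.
  apply/row_subP => i; set z := row i _.
  have : (z <= P :&: kermx (bdry F K k))%MS by apply: row_sub.
  rewrite sub_capmx => /andP[/submxP[y zE] /sub_kermxP dz].
  have zK : chain_on K k (fun s => z 0 (enum_rank s)).
    move=> s zs; suff: s \in fs by rewrite inE => /andP[-> /eqP].
    apply: contraNT zs => sfs; rewrite zE mxE big1 // => j _.
    rewrite mxE enum_rankK; case: eqP => [E|]; last by rewrite mulr0.
    by move: sfs; rewrite -E enum_valP.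
  have [t|w wK wE] := Kk _ zK.
    by have := mul_bdry (enum_rank t) zK; rewrite dz mxE enum_rankK.
  pose w' : 'rV[F]_(#|{: {set T}}|) := \row_j w (enum_val j).
  have w'E s : w' 0 (enum_rank s) = w s by rewrite mxE enum_rankK.
  apply/submxP; exists w'; apply/rowP => j; rewrite mul_bdry.
    by rewrite (eq_bd w'E) wE enum_valK.
  by move=> s; rewrite w'E; apply: wK.
(* Rank-nullity bounds the cycle space below by [nfaces K k - \rank (bdry F K k)], and it lies in
   the image, so the truncated difference is 0. *)
move=> /mxrankS; have := mxrankM_maxr P (bdry F K k).
rewrite rP /rhomology_dim; lia.
Qed.

(** * Graphs without an induced 2K2 *)

Hypothesis e_free : twoK2_free e.

Lemma twoK2P (a b c d : T) : e a b -> e c d ->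
  ~~ e a c -> ~~ e a d -> ~~ e b c -> ~~ e b d -> False.
Proof.
by move=> ab cd ac ad bc bd; apply: e_free; exists a, b, c, d; rewrite ab cd ac ad bc bd.
Qed.

Lemma indepPn s : ~~ indep e s -> exists x y, [/\ x \in s, y \in s & e x y].
Proof.
case/forall_inPn=> x xs /forall_inPn[y ys]; rewrite negbK => xy.
by exists x, y.
Qed.

(** Induction on [#|S :\: B|]: passing to the link lowers [k.*2] by 2, matched by two vertices lost
    outside [B]. The [.+1] forces [1 < k] once [S] meets the complement of [B]. *)
Lemma acyc_bipartition S B k : indep e B -> (#|S :\: B|.+1 < k.*2)%N ->
  acyc (ind_complex e S) k.
Proof.
have [n] := ubnP #|S :\: B|; elim: n S B k => // n IH S B [|k] // Sn BI Sk.
have del x : x \in S :\: B -> acyc (ind_complex e (S :\ x)) k.+1.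
  move=> xA; have E : (S :\ x) :\: B = (S :\: B) :\ x.
    by rewrite !setDDl setUC.
  have := cardsD1 x (S :\: B); rewrite xA => cE.
  apply: (IH _ B) => //; rewrite E; lia.
have [AI|] := boolP (indep e (S :\: B)); last first.
  case/indepPn=> x [y [xA yA xy]]; apply: (@acyc_del S x); first exact: del.
  (* Both [x] and its neighbour [y] lie in the closed neighbourhood of [x]. *)
  have : (#|(S :\: cnbhd e x) :\: B| <= #|(S :\: B) :\ x :\ y|)%N.
    apply: subset_leq_card; apply/subsetP => v; rewrite !inE negb_or.
    case/and3P=> -> /andP[-> vx] ->; rewrite !andbT.
    by apply: contraNneq vx => ->.
  have := cardsD1 x (S :\: B); rewrite xA.
  have := cardsD1 y ((S :\: B) :\ x).
  have -> : y \in (S :\: B) :\ x.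
    by rewrite in_setD1 yA andbT; apply: contraTneq xy => ->; rewrite e_irr.
  move=> c1 c2 c3; apply: (IH _ B) => //; lia.
have [SI|] := boolP (indep e S); first exact: acyc_indep.
case/indepPn=> p [q [pS qS pq]].
(* An edge cannot have both ends in the independent set [B]. *)
have [x0 x0A] : exists x, x \in S :\: B.
  have [pB|pB] := boolP (p \in B); last by exists p; rewrite inE pB.
  exists q; rewrite inE qS andbT; apply: contraTN pq => qB.
  exact: (indepP _ BI).
(* Neighbourhoods into [B] are nested, so deleting the closed neighbourhood of a
   vertex with the largest one destroys every edge. *)
case: (@arg_maxnP _ x0 ([in S :\: B]) (fun x => #|[set b in B | e x b]|) x0A) => x xA0 xmax.
have xA : x \in S :\: B := xA0.
apply: (@acyc_del S x); first exact: del.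
(* The link is treated in size [k], which must be positive for [acyc_indep]. *)
have Sk1 : (0 < k)%N by have := cardsD1 x (S :\: B); rewrite xA; lia.
rewrite -(prednK Sk1); apply: acyc_indep.
have noedge a b : a \in S :\: cnbhd e x -> b \in S :\: cnbhd e x ->
    a \notin B -> e a b -> False.
  rewrite !inE !negb_or => /andP[/andP[ax xa] aS] /andP[/andP[bx xb] bS] aB ab.
  have aA : a \in S :\: B by rewrite inE aB.
  have bB : b \in B.
    apply: contraTT ab => bB; apply: (indepP _ AI) => //; by rewrite inE bB.
  (* Inclusion would be equality by maximality of [x], but [b] is adjacent to [a] only. The
     resulting [c] makes [x c] and [a b] an induced 2K2. *)
  have /subsetPn[c] : ~~ ([set b in B | e x b] \subset [set b in B | e a b]).
    apply/negP=> sub; have : [set b in B | e x b] == [set b in B | e a b].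
      by rewrite eqEcard sub; apply: xmax.
    by move/eqP/setP/(_ b); rewrite !inE bB ab (negbTE xb).
  rewrite !inE => /andP[cB xc]; rewrite cB /= => ac.
  apply: (twoK2P xc ab) => //; first by rewrite e_sym.
  exact: (indepP _ BI).
apply/indepP => a b aS bS; apply/negP => ab.
have [aB|aB] := boolP (a \in B); last exact: (noedge a b).
have [bB|bB] := boolP (b \in B); last by apply: (noedge b a); rewrite // e_sym.
by move: ab; apply/negP; apply: (indepP _ BI).
Qed.

(** The 4 covers 2 for the size lost in the link and the [.+1] of [acyc_bipartition]. *)
Lemma acyc_privacy S k : (max_privacy e + 4 < k.*2)%N -> acyc (ind_complex e S) k.
Proof.
have [n] := ubnP #|S|; elim: n S k => // n IH S [|k] // Sn Sk.
have [SI|] := boolP (indep e S); first exact: acyc_indep.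
case/indepPn=> x [y [xS yS xy]]; apply: (@acyc_del S x).
  by apply: IH => //; have := cardsD1 x S; rewrite xS; lia.
pose B := [set v | ~~ e x v & ~~ e y v].
apply: (@acyc_bipartition _ B).
  apply/indepP=> u v; rewrite !inE => /andP[xu yu] /andP[xv yv].
  by apply/negP=> uv; apply: (twoK2P xy uv).
have : (#|cnbhd e y :\: cnbhd e x| <= max_privacy e)%N.
  by apply: (leq_bigmax_cond (y, x)); rewrite /= e_sym.
(* A vertex outside [B] that is not adjacent to [x] is adjacent to [y]. *)
have : (#|(S :\: cnbhd e x) :\: B| <= #|cnbhd e y :\: cnbhd e x|)%N.
  apply: subset_leq_card; apply/subsetP => v; rewrite !inE.
  case/and3P; rewrite negb_and !negbK => /orP[->|->]; first by rewrite orbT.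
  by move=> -> _; rewrite orbT.
lia.
Qed.

Lemma reg_twoK2_free : ((reg F e).*2 <= max_privacy e + 4)%N.
Proof.
(* Halving isolates [reg], so the maximum can be bounded index by index. *)
suff : (reg F e <= (max_privacy e + 4)./2)%N by lia.
apply/bigmax_leqP => j /existsP[S]; apply: contraR => jk; apply/eqP.
by apply: acyc_rhomology; apply: acyc_privacy; lia.
Qed.

End Chains.

Theorem mainTheorem19 (F : fieldType) (T : finType) (e : rel T) :
  simple_graph e -> twoK2_free e ->
  ((reg F e)%:R <= (max_privacy e)%:R / 2%:R + 2%:R :> rat)%R.
Proof.
move=> e_simple e_free; have := reg_twoK2_free F e_simple e_free.
rewrite -(ler_nat rat) -muln2 natrM natrD => H.
rewrite -(ler_pM2r (_ : 0 < 2%:R :> rat)%R) // mulrDl mulfVK //.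
Qed.
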